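(* Assume $N=\infty$, fix $\mathfrak m\in G_0$, and let $j_1,j_2\in\mathbb{Z}_{\ge0}$. If $C_{L(\mathfrak m+\underline{j_1})}=C_{L(\mathfrak m+\underline{j_2})}$ (as scalars), then $j_1=j_2$.
   Context: Setting. $\mathbb{K}$ is an algebraically closed field of characteristic zero. $R$ is a finitely generated commutative $\mathbb{K}$-algebra, $\sigma$ a $\mathbb{K}$-algebra automorphism of $R$, $h\in R$, $\xi\in\mathbb{K}\setminus\{0\}$. $A=A(R,\sigma,h,\xi)$ is the associative unital algebra obtained from $R$ by adjoining $X_+,X_-$ with relations $X_\pm a=\sigma^{\pm1}(a)X_\pm$ ($a\in R$) and $X_+X_-=h+\xi X_-X_+$. It is assumed that $R$ is a Hopf algebra with structure $(\Delta,\varepsilon,S)$ and that there are $r_\pm,l_\pm,s_\pm\in R$ with: $(\sigma\otimes\mathrm{Id})\Delta=\Delta\sigma=(\mathrm{Id}\otimes\sigma)\Delta$ and $S\sigma=\sigma^{-1}S$ on $R$; $\Delta(h)=h\otimes r_+r_-+l_+l_-\otimes h$, $\varepsilon(h)=0$, $S(h)=-(l_+l_-r_+r_-)^{-1}h$; $r_\pm,l_\pm$ grouplike (i.e. $\Delta(x)=x\otimes x$ for each of these elements $x$); $\sigma(l_\pm)\otimes\sigma(r_\mp)=\xi\,l_\pm\otimes r_\mp$; $(s_\pm)^{-1}=-l_\pm\sigma^{\pm1}(r_\pm)$. Then $A$ is a Hopf algebra extending $R$ via $\Delta(X_\pm)=X_\pm\otimes r_\pm+l_\pm\otimes X_\pm$,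 $\varepsilon(X_\pm)=0$, $S(X_\pm)=s_\pm X_\pm$. Group of weights. $G$ is the set of maximal ideals of $R$. For $\mathfrak m\in G$, $a\in R$, $a(\mathfrak m)\in\mathbb{K}$ is the unique scalar with $a-a(\mathfrak m)\in\mathfrak m$. $G$ is a group (written additively, not necessarily abelian) with $\mathfrak m+\mathfrak n=\ker\big(a\mapsto\sum a'(\mathfrak m)a''(\mathfrak n)\big)$ where $\Delta(a)=\sum a'\otimes a''$, unit $\underline{0}=\ker\varepsilon|_R$, inverse $-\mathfrak m=S(\mathfrak m)$. For $n\in\mathbb{Z}$, $\underline{n}=\sigma^n(\underline{0})$, and $\underline{\mathbb{Z}}=\{\underline n:n\in\mathbb{Z}\}$. Torsion-freeness is assumed: $\sigma^n(\mathfrak m)\ne\mathfrak m$ for all $n\in\mathbb{Z}\setminus\{0\}$, $\mathfrak m\in G$. Modules. For an $A$-module $V$, $V_{\mathfrak m}=\{v\in V:\mathfrak m v=0\}$, $\mathrm{Supp}(V)=\{\mathfrak m\in G:V_{\mathfrak m}\neq0\}$, and $V$ is a weight module if $V=\bigoplus_{\mathfrak m\in G}V_{\mathfrak m}$. $M(\mathfrak m)=A/(AX_++A\mathfrak m)$ is the Verma module and $L(\mathfrak m)$ its unique simple quotient (a weight module). Notation. $G_0=\{\mathfrak m\in G:h(\mathfrak m)=0\}$; $r=r_+r_-$, $r_1=r(\underline{1})$ (a nonzero scalar). $N$ is the order of $\xi r_1$ if $(\xi r_1)^2\ne1$ and $\xi r_1$ is a root of unity, and $N=\infty$ otherwise.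 Casimir operator. Put $t=X_-X_+\in A$; the subalgebra $R[t]\subseteq A$ is a polynomial ring over $R$, and $\sigma$ extends to an automorphism of $R[t]$ by $\sigma(t)=h+\xi t$. For fixed $\mathfrak m\in G_0$ and a finite-dimensional weight $A$-module $V$ with $\mathrm{Supp}(V)\subseteq\mathfrak m+\underline{\mathbb{Z}}$, the linear map $C_V:V\to V$ is defined by $C_Vv=\sigma^j(t)v$ for $v\in V_{\mathfrak m+\underline{j}}$, $j\in\mathbb{Z}$. It is an $A$-module endomorphism, hence acts as a scalar on every such simple $V$; this scalar is also denoted $C_V$. The modules $L(\mathfrak m+\underline{j})$, $j\ge0$, are finite-dimensional with support in $\mathfrak m+\underline{\mathbb{Z}}$.
   Formalization: The formal theorem adds the hypothesis h(1) ≠ 0 (h evaluated at the weight 1 = σ(0)); without it every C_{L(m+j)} is 0 and the claim fails, e.g. R=K[H] with H primitive, σ(H)=H−1, h=0, ξ=1, r_±=l_±=1, s_±=−1. *)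

(* Defs.v *)
From HB Require Import structures.
From mathcomp Require Import all_boot all_order all_algebra.
From mathcomp Require Import boolp classical_sets.

Set Implicit Arguments.
Unset Strict Implicit.
Unset Printing Implicit Defensive.

Import GRing.Theory.

Local Open Scope quotient_scope.
Local Open Scope classical_set_scope.
Local Open Scope ring_scope.

(* The tensor product of two K-vector spaces.  An element is a class of formal
   sums [:: (u_1, v_1); ...; (u_n, v_n)], standing for \sum_i u_i (x) v_i; two
   formal sums are identified when no bilinear map distinguishes them. *)
Section Tensor.
Variable K : fieldType.
Implicit Types U V W : lmodType K.

Definition is_bilinear U V W (b : U -> V -> W) : Prop :=
  (forall v, linear (b^~ v)) /\ (forall u, linear (b u)).

Section Def.
Variables U V : lmodType K.

Definition sum_bil W (b : U -> V -> W) (s : seq (U * V)) : W :=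
  \sum_(p <- s) b p.1 p.2.

Definition tensor_rel : rel (seq (U * V)) := fun s t =>
  `[< forall W (b : U -> V -> W), is_bilinear b -> sum_bil b s = sum_bil b t >].

Lemma tensor_rel_refl : reflexive tensor_rel.
Proof. by move=> s; apply/asboolP. Qed.

Lemma tensor_rel_sym : symmetric tensor_rel.
Proof. by move=> s t; apply/asboolP/asboolP => st W b /st. Qed.

Lemma tensor_rel_trans : transitive tensor_rel.
Proof.
move=> t s u /asboolP st /asboolP tu; apply/asboolP => W b bb.
by rewrite st // tu.
Qed.

Canonical tensor_equiv :=
  EquivRel tensor_rel tensor_rel_refl tensor_rel_sym tensor_rel_trans.

Definition tensor := {eq_quot tensor_equiv}.
HB.instance Definition _ : EqQuotient _ tensor_equiv tensor :=
  EqQuotient.on tensor.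
HB.instance Definition _ := Choice.on tensor.

Definition tens (u : U) (v : V) : tensor := \pi_tensor [:: (u, v)].

(* The value at a tensor of the linear map induced by b; it does not depend on
   the chosen representative when b is bilinear, see tlift_pi. *)
Definition tlift W (b : U -> V -> W) (x : tensor) : W := sum_bil b (repr x).

Lemma tensor_relP s t :
  reflect (forall W (b : U -> V -> W), is_bilinear b ->
             sum_bil b s = sum_bil b t)
          (\pi_tensor s == \pi_tensor t).
Proof. by rewrite eqmodE; exact: asboolP. Qed.

Lemma tlift_pi W (b : U -> V -> W) s :
  is_bilinear b -> tlift b (\pi_tensor s) = sum_bil b s.
Proof.
by move=> bb; apply/tensor_relP; [rewrite reprK | exact: bb].
Qed.

Lemma tensor_eqP (x y : tensor) :
  (forall W (b : U -> V -> W), is_bilinear b -> tlift b x = tlift b y) ->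
  x = y.
Proof.
by move=> xy; rewrite -[x]reprK -[y]reprK; apply/eqP/tensor_relP => W b /xy.
Qed.

Definition tensor_add (x y : tensor) : tensor := \pi_tensor (repr x ++ repr y).
Definition tensor_scale (c : K) (x : tensor) : tensor :=
  \pi_tensor [seq (c *: p.1, p.2) | p <- repr x].
Definition tensor_zero : tensor := \pi_tensor [::].
Definition tensor_opp (x : tensor) : tensor := tensor_scale (-1) x.

Lemma tlift_add W (b : U -> V -> W) x y :
  is_bilinear b -> tlift b (tensor_add x y) = tlift b x + tlift b y.
Proof. by move=> bb; rewrite tlift_pi // /tlift /sum_bil big_cat. Qed.

Lemma tlift_zero W (b : U -> V -> W) :
  is_bilinear b -> tlift b tensor_zero = 0.
Proof. by move=> bb; rewrite tlift_pi // /sum_bil big_nil. Qed.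

Lemma tlift_scale W (b : U -> V -> W) c x :
  is_bilinear b -> tlift b (tensor_scale c x) = c *: tlift b x.
Proof.
move=> bb; rewrite tlift_pi // /tlift /sum_bil big_map scaler_sumr.
by apply: eq_bigr => p _ /=; have /scalable_linear := bb.1 p.2; apply.
Qed.

Definition tliftE := (tlift_add, tlift_zero, tlift_scale).

Lemma tensor_addA : associative tensor_add.
Proof. by move=> x y z; apply: tensor_eqP => W b bb; rewrite !tliftE // addrA. Qed.

Lemma tensor_addC : commutative tensor_add.
Proof. by move=> x y; apply: tensor_eqP => W b bb; rewrite !tliftE // addrC. Qed.

Lemma tensor_add0 : left_id tensor_zero tensor_add.
Proof. by move=> x; apply: tensor_eqP => W b bb; rewrite !tliftE // add0r. Qed.

Lemma tensor_addN : left_inverse tensor_zero tensor_opp tensor_add.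
Proof.
by move=> x; apply: tensor_eqP => W b bb; rewrite !tliftE // scaleN1r addNr.
Qed.

HB.instance Definition _ := GRing.isZmodule.Build tensor
  tensor_addA tensor_addC tensor_add0 tensor_addN.

Lemma tensor_scaleA c d x :
  tensor_scale c (tensor_scale d x) = tensor_scale (c * d) x.
Proof. by apply: tensor_eqP => W b bb; rewrite !tliftE // scalerA. Qed.

Lemma tensor_scale1 : left_id 1 tensor_scale.
Proof. by move=> x; apply: tensor_eqP => W b bb; rewrite !tliftE // scale1r. Qed.

Lemma tensor_scaleDr : right_distributive tensor_scale +%R.
Proof.
move=> c x y; apply: tensor_eqP => W b bb.
by rewrite tlift_scale // !tlift_add // !tlift_scale // scalerDr.
Qed.

Lemma tensor_scaleDl x : {morph tensor_scale^~ x : c d / c + d}.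
Proof.
move=> c d; apply: tensor_eqP => W b bb.
by rewrite tlift_scale // tlift_add // !tlift_scale // scalerDl.
Qed.

HB.instance Definition _ := GRing.Zmodule_isLmodule.Build K tensor
  tensor_scaleA tensor_scale1 tensor_scaleDr tensor_scaleDl.

End Def.
End Tensor.

Section TensorTheory.
Variables (K : fieldType) (U V : lmodType K).

Lemma tens_is_bilinear : is_bilinear (@tens K U V).
Proof.
split=> [v c u u'|u c v v']; apply: tensor_eqP => W b bb;
  rewrite [tlift b (_ + _)]tlift_add // [tlift b (_ *: _)]tlift_scale //;
  rewrite !tlift_pi // /sum_bil !big_seq1 /=; [exact: bb.1 | exact: bb.2].
Qed.

Lemma tlift_tens (W : lmodType K) (b : U -> V -> W) u v :
  is_bilinear b -> tlift b (tens u v) = b u v.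
Proof. by move=> bb; rewrite tlift_pi // /sum_bil big_seq1. Qed.

Lemma tlift_is_linear (W : lmodType K) (b : U -> V -> W) : is_bilinear b -> linear (tlift b).
Proof.
by move=> bb c x y; rewrite [LHS]tlift_add // [tlift b (_ *: _)]tlift_scale.
Qed.

Lemma tensE (x : tensor U V) : x = \sum_(p <- repr x) tens p.1 p.2.
Proof.
apply: tensor_eqP => W b bb.
pose B := HB.pack_for {linear tensor U V -> W} (tlift b)
  (GRing.isLinear.Build _ _ _ _ _ (tlift_is_linear bb)).
rewrite -[RHS]/(B _) linear_sum; apply: eq_bigr => p _ /=.
by rewrite tlift_tens.
Qed.

End TensorTheory.

Notation "U '(x)' V" := (tensor U V) (at level 40, left associativity)
  : type_scope.
Notation "u '(x)' v" := (tens u v) (at level 40, left associativity)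
  : ring_scope.

Section TensorMaps.
Variable K : fieldType.
Implicit Types U V W : lmodType K.

Definition tmap U V U' V' (f : U -> U') (g : V -> V') (x : tensor U V)
  : tensor U' V' := tlift (fun u v => f u (x) g v) x.

Definition tassoc U V W (x : tensor (tensor U V) W) : tensor U (tensor V W) :=
  tlift (fun y w => tlift (fun u v => u (x) (v (x) w)) y) x.

Definition tmul (A : algType K) (x y : tensor A A) : tensor A A :=
  tlift (fun a b => tlift (fun c d => (a * c) (x) (b * d)) y) x.

End TensorMaps.

Record hopf (K : fieldType) (R : comAlgType K) := Hopf {
  comul : {linear R -> tensor R R};
  counit : {linear R -> K^o};
  antipode : {linear R -> R};
  comulM : forall a b, comul (a * b) = tmul (comul a) (comul b);
  comul1 : comul 1 = 1 (x) 1;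
  counitM : forall a b, counit (a * b) = counit a * counit b;
  counit1 : counit 1 = 1;
  comulA : forall a, tassoc (tmap comul id (comul a)) = tmap id comul (comul a);
  counitl : forall a, tlift (fun a' a'' => counit a' *: a'') (comul a) = a;
  counitr : forall a, tlift (fun a' a'' => counit a'' *: a') (comul a) = a;
  antipodel :
    forall a, tlift (fun a' a'' => antipode a' * a'') (comul a) = (counit a)%:A;
  antipoder :
    forall a, tlift (fun a' a'' => a' * antipode a'') (comul a) = (counit a)%:A
}.

Section Ambiskew.
Variables (K : fieldType) (R : comAlgType K).

Definition fin_gen : Prop :=
  exists s : seq R, forall P : set R,
    (forall c : K, P c%:A) ->
    (forall a b, P a -> P b -> P (a + b)) ->
    (forall a b, P a -> P b -> P (a * b)) ->
    (forall a, a \in s -> P a) ->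
    forall a, P a.

Variables (sigma sigmaV : {lrmorphism R -> R}).

(* sigma ^ n for n in Z, given the inverse sigmaV of sigma *)
Definition sigmaZ (n : int) : R -> R :=
  match n with
  | Posz k => iter k sigma
  | Negz k => iter k.+1 sigmaV
  end.

Definition grouplike (H : hopf R) (x : R) : Prop := comul H x = x (x) x.

Record hopf_datum (H : hopf R) (h : R) (xi : K) (rp rm lp lm sp sm : R)
    : Prop := HopfDatum {
  sigma_comull : forall a, tmap sigma id (comul H a) = comul H (sigma a);
  sigma_comulr : forall a, tmap id sigma (comul H a) = comul H (sigma a);
  sigma_antipode : forall a, antipode H (sigma a) = sigmaV (antipode H a);
  comul_h : comul H h = h (x) (rp * rm) + (lp * lm) (x) h;
  counit_h : counit H h = 0;
  antipode_h :
    exists2 u, u * (lp * lm * rp * rm) = 1 & antipode H h = - (u * h);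
  grouplike_rp : grouplike H rp;
  grouplike_rm : grouplike H rm;
  grouplike_lp : grouplike H lp;
  grouplike_lm : grouplike H lm;
  sigma_lprm : sigma lp (x) sigma rm = xi *: (lp (x) rm);
  sigma_lmrp : sigma lm (x) sigma rp = xi *: (lm (x) rp);
  inv_sp : sp * - (lp * sigma rp) = 1;
  inv_sm : sm * - (lm * sigmaV rm) = 1
}.

Section Presentation.
Variables (h : R) (xi : K).

Definition ambiskew_rel (B : algType K) (f : R -> B) (yp ym : B) : Prop :=
  [/\ forall a, yp * f a = f (sigma a) * yp,
      forall a, ym * f a = f (sigmaV a) * ym &
      yp * ym = f h + xi *: (ym * yp)].

(* A, with iota : R -> A and Xp, Xm in A, is the algebra obtained from R by
   adjoining X_+, X_- subject to the relations: it is universal for them. *)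
Definition is_ambiskew (A : algType K) (iota : {lrmorphism R -> A})
    (Xp Xm : A) : Prop :=
  ambiskew_rel iota Xp Xm /\
  forall (B : algType K) (f : {lrmorphism R -> B}) (yp ym : B),
    ambiskew_rel f yp ym ->
    exists g : {lrmorphism A -> B},
      [/\ forall a, g (iota a) = f a, g Xp = yp & g Xm = ym] /\
      forall g' : {lrmorphism A -> B},
        [/\ forall a, g' (iota a) = f a, g' Xp = yp & g' Xm = ym] ->
        g' =1 g.

(* The extension of sigma to R[t] with sigma(t) = h + xi t, and its inverse. *)
Definition sigmat (p : {poly R}) : {poly R} :=
  map_poly sigma p \Po (h%:P + xi%:A *: 'X).
Definition sigmatV (p : {poly R}) : {poly R} :=
  map_poly sigmaV p \Po (xi^-1%:A *: ('X - (sigmaV h)%:P)).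
Definition sigmatZ (n : int) : {poly R} -> {poly R} :=
  match n with
  | Posz k => iter k sigmat
  | Negz k => iter k.+1 sigmatV
  end.

Lemma sigmatK :
  xi != 0 -> cancel sigma sigmaV -> cancel sigmat sigmatV.
Proof.
move=> xi0 sK p; rewrite /sigmat /sigmatV map_comp_poly -comp_polyA.
have -> : map_poly sigmaV (map_poly sigma p) = p.
  by apply/polyP => i; rewrite !coef_map /= sK.
rewrite rmorphD /= map_polyC /= map_polyZ /= map_polyX linearZ /= rmorph1.
rewrite comp_polyD comp_polyC comp_polyZ comp_polyX scalerA.
by rewrite -scalerAl mul1r scalerA mulfV // !scale1r subrKC comp_polyXr.
Qed.

End Presentation.

Definition is_ideal (m : set R) : Prop :=
  [/\ m 0, forall a b, m a -> m b -> m (a + b) & forall a b, m b -> m (a * b)].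

(* m is an element of the group G *)
Definition maximal_ideal (m : set R) : Prop :=
  [/\ is_ideal m, ~ m 1 &
      forall n : set R, is_ideal n -> m `<=` n -> ~ n 1 -> n = m].

(* a(m); the default 0 is never used when m is a maximal ideal *)
Definition ev (m : set R) (a : R) : K := xget 0 [set c : K | m (a - c%:A)].

Section Weights.
Variable H : hopf R.

Definition wadd (m n : set R) : set R :=
  [set a | tlift (fun a' a'' => (ev m a' * ev n a'' : K^o)) (comul H a) = 0].

Definition wzero : set R := [set a | counit H a = 0].

Definition wint (n : int) : set R := sigmaZ n @` wzero.

Definition torsion_free : Prop :=
  forall (n : int) (m : set R),
    n != 0 -> maximal_ideal m -> sigmaZ n @` m <> m.

End Weights.
End Ambiskew.

(* The N of the setting, for q = xi r_1; None stands for infinity. *)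
Definition order_N (K : fieldType) (q : K) : option nat :=
  match pselect (exists n, n.-primitive_root q) with
  | left ex => if q ^+ 2 != 1 then Some (ex_minn ex) else None
  | right _ => None
  end.

Section Modules.
Variables (K : fieldType) (R : comAlgType K) (A : algType K).
Variables (iota : {lrmorphism R -> A}) (Xp Xm : A).

Definition weight_space (V : lmodType A) (m : set R) : set V :=
  [set v | forall a, m a -> iota a *: v = 0].

(* the left ideal A X_+ + A m *)
Definition verma_ideal (m : set R) : set A :=
  [set x | exists (y : A) (s : seq (A * R)),
     (forall p, p \in s -> m p.2) /\
     x = y * Xp + \sum_(p <- s) p.1 * iota p.2].

Definition is_verma (m : set R) (M : lmodType A) : Prop :=
  exists pi : {linear A^o -> M},
    (forall v, exists x, pi x = v) /\
    (forall x, pi x = 0 <-> verma_ideal m x).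

Definition is_submodule (V : lmodType A) (U : set V) : Prop :=
  [/\ U 0, forall u v, U u -> U v -> U (u + v) &
      forall (x : A) u, U u -> U (x *: u)].

Definition is_simple (V : lmodType A) : Prop :=
  (exists v : V, v <> 0) /\
  forall U : set V, is_submodule U -> U = [set 0] \/ U = setT.

(* V is (isomorphic to) L(m) *)
Definition is_simple_quotient_verma (m : set R) (V : lmodType A) : Prop :=
  is_simple V /\
  exists M : lmodType A, is_verma m M /\
    exists rho : {linear M -> V}, forall v, exists x, rho x = v.

(* evaluation at t = X_- X_+, identifying R[t] with a subalgebra of A *)
Definition evalt (p : {poly R}) : A := (map_poly iota p).[Xm * Xp].

(* C is a map C_V: K-linear, and acting on V_(m + j) as sigma^j(t).  These
   conditions determine C when V is a weight module supported in m + Z. *)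
Definition is_casimir (sigma sigmaV : {lrmorphism R -> R}) (h : R) (xi : K)
    (H : hopf R) (m : set R) (V : lmodType A) (C : V -> V) : Prop :=
  (forall (c : K) (v w : V), C (c%:A *: v + w) = c%:A *: C v + C w) /\
  (forall (j : int) (v : V),
     weight_space (wadd H m (wint sigma sigmaV H j)) v ->
     C v = evalt (sigmatZ sigma sigmaV h xi j 'X) *: v).

End Modules.

(* Main.v *)
Require Import Defs.
From HB Require Import structures.
From mathcomp Require Import all_boot all_order all_algebra.
From mathcomp Require Import boolp classical_sets ring.

Set Implicit Arguments.
Unset Strict Implicit.
Unset Printing Implicit Defensive.

Import GRing.Theory.

Local Open Scope classical_set_scope.
Local Open Scope ring_scope.

(* By the Nullstellensatz m is the kernel of a character phi of R, and
   convolution shows that m + j is the kernel of phi o sigma^-j.  On the highest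
   weight vector t = X_- X_+ vanishes, so C acts on L(m + j) as
   sigma^j(t) - xi^j t = \sum_(k < j) xi^k sigma^(j-1-k)(h) evaluated at m + j,
   which is \sum_(k < j) xi^k phi(sigma^-(k+1) h).  The formula for Delta(h) and
   phi(h) = 0 turn this, with q = xi r_1 and l = l_+ l_-, into
   l(m) h(1) \sum_(k < j) u_k, where u_k is q^k + q^(k-2) + ... + q^-k, because
   the twist relations force xi l(1) = q^-1.  This sum is an affine function of
   q^(j+1) + q^-j when q^2 <> 1, of (2j+1)^2 when q = 1, and of (-1)^j (2j+1)
   when q = -1; each is injective in j as soon as q has no finite order N. *)

(** * Zariski's lemma and the Nullstellensatz *)

Section LocalIntegrality.
Variables (F : fieldType) (D : comNzRingType) (f : {rmorphism D -> F}).

(** Multiplying [p(x) = 0] by [a ^+ n], with [n] the degree, gives [x ^+ i] the factor [a ^+ i] and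
    leaves [a ^+ (n - i)] on its coefficient; the leading coefficient is unchanged. *)
Lemma root_scaled (a x : F) (p : {poly F}) :
  root p x -> root (\poly_(i < size p) (p`_i * a ^+ ((size p).-1 - i))) (a * x).
Proof.
move=> /rootP px; apply/rootP; rewrite horner_poly.
transitivity (a ^+ (size p).-1 * p.[x]); last by rewrite px mulr0.
rewrite horner_coef mulr_sumr; apply: eq_bigr => -[i /= lt_i] _.
have le_i : (i <= (size p).-1)%N by rewrite -ltnS prednK // (leq_ltn_trans _ lt_i).
by rewrite -[in RHS](subnK le_i) exprD exprMn [RHS]mulrACA [X in _ = X * _]mulrC.
Qed.

Lemma integral_exp u n : integralOver f u -> integralOver f (u ^+ n).
Proof.
move=> fu; elim: n => [|n IHn]; first by rewrite expr0; apply: integral1.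
by rewrite exprS; apply: integral_mul.
Qed.

(** Rescaling the root by the leading coefficient [f c] gives every lower coefficient a factor
    [f c], so dividing by [f c] makes the equation monic without leaving the image of [f]. *)
Lemma integral_scaled_root (p : {poly D}) x :
    map_poly f p != 0 -> root (map_poly f p) x ->
  exists2 c, f c != 0 & integralOver f (f c * x).
Proof.
set q := map_poly f p => q0 qx; pose c := p`_(size q).-1.
have fcE : f c = lead_coef q by rewrite -coef_map lead_coefE.
have fc0 : f c != 0 by rewrite fcE lead_coef_eq0.
exists c => //; have := root_scaled (f c) qx.
set r := \poly_(i < _) _ => rcx.
have q_gt0 : (0 < size q)%N by rewrite size_poly_gt0.
have rE i : r`_i = q`_i * f c ^+ ((size q).-1 - i).
  by rewrite coef_poly; case: ltnP => // ?; rewrite nth_default ?mul0r.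
have rl : r`_(size q).-1 = f c by rewrite rE subnn mulr1 fcE lead_coefE.
have lead_r : lead_coef r = f c.
  rewrite lead_coefE; suff -> : size r = size q by [].
  apply/eqP; rewrite eqn_leq size_poly -(prednK q_gt0) ltnNge.
  by apply: contraNN fc0 => /(nth_default 0); rewrite rl => ->.
apply: (@integral_root_monic _ _ _ _ ((f c)^-1 *: r)).
- by rewrite monicE lead_coefZ lead_r mulVf.
- by rewrite rootZ // invr_eq0.
apply/integral_poly => i; rewrite coefZ rE.
case: (ltngtP i (size q).-1) => [lt_i|gt_i|->].
- rewrite -(subnSK lt_i) exprS mulrCA mulKf //.
  rewrite coef_map -rmorphXn -rmorphM; apply: integral_id.
- rewrite nth_default; last by rewrite -(prednK q_gt0).
  by rewrite mul0r mulr0; apply: integral0.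
- by rewrite -lead_coefE -fcE subnn mulr1 mulVf //; apply: integral1.
Qed.

(** The reversal of a monic equation for [x] is an equation for [x^-1], nonzero because its constant
    term is 1. *)
Lemma integral_scaled_inv x :
  x != 0 -> integralOver f x -> exists2 c, f c != 0 & integralOver f (f c / x).
Proof.
move=> x0 [p mon_p px].
pose q := \poly_(i < size p) p`_((size p).-1 - i).
have p_gt0 : (0 < size p)%N by rewrite size_poly_gt0 monic_neq0.
have q0 : map_poly f q != 0.
  apply/eqP => /polyP/(_ 0)/eqP; rewrite coef_map coef_poly p_gt0 subn0 coef0.
  by rewrite /= -lead_coefE (monicP mon_p) rmorph1 oner_eq0.
apply: (integral_scaled_root q0); apply/rootP.
apply: (mulfI (expf_neq0 (size p).-1 x0)); rewrite mulr0 -(rootP px).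
rewrite (@horner_coef_wide _ (size p)) ?size_map_poly; last first.
  by rewrite (leq_trans (size_poly _ _)) // size_poly.
rewrite (@horner_coef_wide _ (size p)) ?size_poly //.
rewrite mulr_sumr [RHS](reindex_inj rev_ord_inj) /=.
apply: eq_bigr => -[i /= lt_i] _; rewrite !coef_map coef_poly lt_i.
have le_i : (i <= (size p).-1)%N by rewrite -ltnS prednK.
have -> : (size p - i.+1 = (size p).-1 - i)%N by rewrite -subn1 -subnDA add1n.
rewrite mulrCA; congr (_ * _).
by rewrite -[in LHS](subnK le_i) exprD exprVn mulfK // expf_neq0.
Qed.

(* u is integral over the localisation of f(D) at f(d). *)
Definition loc_integral d u := exists N, integralOver f (f d ^+ N * u).

Lemma loc_integralW d u N :
  integralOver f (f d ^+ N * u) ->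
  forall M, (N <= M)%N -> integralOver f (f d ^+ M * u).
Proof.
move=> du M /subnK <-; rewrite exprD -mulrA; apply: integral_mul => //.
exact/integral_exp/integral_id.
Qed.

Lemma loc_integral_id d a : loc_integral d (f a).
Proof. by exists 0%N; rewrite expr0 mul1r; apply: integral_id. Qed.

Lemma loc_integralD d u v :
  loc_integral d u -> loc_integral d v -> loc_integral d (u + v).
Proof.
move=> [M du] [N dv]; exists (maxn M N); rewrite mulrDr; apply: integral_add.
  exact: loc_integralW du _ (leq_maxl _ _).
exact: loc_integralW dv _ (leq_maxr _ _).
Qed.

Lemma loc_integralM d u v :
  loc_integral d u -> loc_integral d v -> loc_integral d (u * v).
Proof.
by move=> [M du] [N dv]; exists (M + N)%N; rewrite exprD mulrACA; apply: integral_mul.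
Qed.

Lemma loc_integralX d u n : loc_integral d u -> loc_integral d (u ^+ n).
Proof.
move=> du; elim: n => [|n IHn].
  by rewrite expr0 -(rmorph1 f); apply: loc_integral_id.
by rewrite exprS; apply: loc_integralM.
Qed.

Lemma loc_integral_mulr d e u : loc_integral d u -> loc_integral (d * e) u.
Proof.
move=> [N du]; exists N; rewrite rmorphM exprMn mulrAC.
by apply: integral_mul => //; apply/integral_exp/integral_id.
Qed.

Lemma loc_integral_horner d (p : {poly D}) x :
  loc_integral d x -> loc_integral d (map_poly f p).[x].
Proof.
move=> dx; elim/poly_ind: p => [|p a IHp].
  by rewrite rmorph0 horner0 -(rmorph0 f); apply: loc_integral_id.
rewrite rmorphD rmorphM /= map_polyX map_polyC hornerD hornerMX hornerC.
by apply: loc_integralD; [apply: loc_integralM|apply: loc_integral_id].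
Qed.

(** The finitely many coefficients share one exponent [N]. Rescaling the root by [f d ^+ N] keeps
    the equation monic and makes its coefficients integral; integrality is transitive. *)
Lemma loc_integral_root_monic d (p : {poly F}) x :
  p \is monic -> root p x -> (forall i, loc_integral d p`_i) -> loc_integral d x.
Proof.
move=> mon_p px /choice[g gP]; pose N := \max_(i < size p) g i.
have pN i : integralOver f (f d ^+ N * p`_i).
  have [lt_i|ge_i] := ltnP i (size p); last first.
    by rewrite nth_default // mulr0; apply: integral0.
  by apply: loc_integralW (gP i) _ _; apply: (leq_bigmax (Ordinal lt_i)).
exists N; have := root_scaled (f d ^+ N) px; set r := \poly_(i < _) _ => rx.
have p_gt0 : (0 < size p)%N by rewrite size_poly_gt0 monic_neq0.
have rE i : r`_i = p`_i * (f d ^+ N) ^+ ((size p).-1 - i).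
  by rewrite coef_poly; case: ltnP => // ?; rewrite nth_default ?mul0r.
have rl : r`_(size p).-1 = 1.
  by rewrite rE subnn mulr1 -lead_coefE (monicP mon_p).
apply: (@integral_root_monic _ _ _ _ r) => //.
  rewrite monicE lead_coefE; suff -> : size r = size p by rewrite rl.
  apply/eqP; rewrite eqn_leq size_poly -(prednK p_gt0) ltnNge.
  by apply/negP => /(nth_default 0)/eqP; rewrite rl oner_eq0.
apply/integral_poly => i; have [->|ne_i] := eqVneq i (size p).-1.
  by rewrite rl; apply: integral1.
have [lt_i|ge_i] := ltnP i (size p); last first.
  by rewrite rE nth_default // mul0r; apply: integral0.
have {ne_i lt_i}lt_i : (i < (size p).-1)%N.
  by rewrite ltn_neqAle ne_i -ltnS prednK.
rewrite rE -(subnSK lt_i) exprS mulrA [p`_i * _]mulrC.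
by apply: integral_mul; [|apply/integral_exp/integral_exp/integral_id].
Qed.

End LocalIntegrality.

(* The hypothesis says that F is generated as a ring by f(D) and s.  In the
   induction D is replaced by {poly D}, acting through 'X |-> x.  If x is
   transcendental over f(D), then 1 + x d is not invertible after inverting d. *)
Lemma zariski (F : fieldType) (s : seq F) (D : comNzRingType)
    (f : {rmorphism D -> F}) :
  (forall P : F -> Prop, (forall a, P (f a)) ->
     (forall u v, P u -> P v -> P (u + v)) ->
     (forall u v, P u -> P v -> P (u * v)) ->
     (forall u, u \in s -> P u) -> forall u, P u) ->
  exists2 d, f d != 0 & forall u, loc_integral f d u.
Proof.
elim: s D f => [|x s IHs] D f gen.
  exists 1; first by rewrite rmorph1 oner_eq0.
  apply: gen => // [a|u v|u v]; first exact: loc_integral_id.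
    exact: loc_integralD.
  exact: loc_integralM.
pose fx : {rmorphism {poly D} -> F} := horner_morph (fun a => mulrC x (f a)).
have fxE p : fx p = (map_poly f p).[x] by [].
have [P Pf PD PM Ps|d1 d1_neq0 d1P] := IHs _ fx.
  apply: gen => // [a|u].
    by have := Pf a%:P; rewrite fxE map_polyC hornerC.
  rewrite inE => /predU1P[->|]; last exact: Ps.
  by have := Pf 'X; rewrite fxE map_polyX hornerX.
set y := fx d1 in d1_neq0 d1P.
have [[p [p_neq0 px]]|trx] := pselect
    (exists p, map_poly f p != 0 /\ root (map_poly f p) x).
(* Algebraic case: inverting [c] makes [x], hence [y], integral, and inverting [e] as well does the
   same for [y^-1]. *)
- have [c c_neq0 cx] := integral_scaled_root p_neq0 px.
  have c_x : loc_integral f c x by exists 1%N.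
  have [N cy] : loc_integral f c y by apply: loc_integral_horner.
  have cy_neq0 : f c ^+ N * y != 0 by rewrite mulf_neq0 // expf_neq0.
  have [e e_neq0 ey] := integral_scaled_inv cy_neq0 cy.
  exists (c * e); first by rewrite rmorphM mulf_neq0.
  have d_yV : loc_integral f (c * e) y^-1.
    exists 1%N; rewrite expr1 rmorphM.
    have -> : f c * f e / y = f c ^+ N.+1 * (f e / (f c ^+ N * y)).
      rewrite exprS invfM -!mulrA; congr (_ * _).
      by rewrite [in RHS]mulrCA [f c ^+ N * _]mulrA mulfV ?mul1r // expf_neq0.
    apply: integral_mul => //; exact/integral_exp/integral_id.
  move=> u; have [M [q mon_q qy]] := d1P u.
  have -> : u = y ^- M * (y ^+ M * u) by rewrite mulKf // expf_neq0.
  rewrite -exprVn; apply: loc_integralM; first exact: loc_integralX.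
  apply: (loc_integral_root_monic _ qy) => [|i]; first exact: monic_map.
  rewrite coef_map /= fxE; apply/loc_integral_mulr.
  exact: loc_integral_horner.
exfalso.
have inj p : fx p = 0 -> map_poly f p = 0.
  move=> px; apply: contrapT => /eqP p_neq0.
  by apply: trx; exists p; split=> //; apply/rootP.
(* Over [F], [g] is nonconstant and coprime to [d1], so it divides no power of [d1]; integrality of
   [(fx g)^-1] up to a power of [y] will force it to divide one. *)
pose g := 1 + 'X * d1.
have d1f_neq0 : map_poly f d1 != 0.
  by apply: contraNneq d1_neq0 => e; rewrite /y fxE e horner0.
have gfE : map_poly f g = 1 + 'X * map_poly f d1.
  by rewrite rmorphD rmorph1 rmorphM /= map_polyX.
have g_size : size (map_poly f g) = (size (map_poly f d1)).+1.
  rewrite gfE addrC size_polyDl mulrC size_mulX // size_poly1 ltnS.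
  by rewrite size_poly_gt0.
have g_neq0 : fx g != 0.
  by apply/eqP => /inj/eqP; rewrite -size_poly_eq0 g_size.
have [N [q mon_q qg]] := d1P (fx g)^-1.
have [b bE] : exists b, y ^+ (N * (size q).-1) = fx (g * b).
  (* Multiplying the monic equation of [y ^+ N / fx g] by [fx g ^+ (size q).-1] isolates the power
     of [y]. Every other term keeps a factor [fx g]; removing one such factor leaves [b]. *)
  exists (- \sum_(i < (size q).-1)
    q`_i * d1 ^+ (N * i) * g ^+ ((size q).-2 - i)).
  move/rootP: qg; rewrite (@horner_coef_wide _ (size q)) ?size_poly //.
  have q_gt0 : (0 < size q)%N by rewrite size_poly_gt0 monic_neq0.
  move/(congr1 ( *%R^~ (fx g ^+ (size q).-1))); rewrite mul0r mulr_suml.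
  rewrite -[in X in X = _](prednK q_gt0) big_ord_recr /= coef_map -lead_coefE.
  rewrite (monicP mon_q) /= rmorph1 mul1r exprMn exprVn -!mulrA mulVf ?expf_neq0 //.
  rewrite mulr1 addrC => /eqP; rewrite addr_eq0 -exprM => /eqP->.
  rewrite mulrN rmorphN mulr_sumr rmorph_sum; congr (- _).
  apply: eq_bigr => -[i /= lt_i] _.
  rewrite coef_map !rmorphM !rmorphXn /= -/y exprMn -exprM exprVn.
  set k := ((size q).-2 - i)%N.
  have -> : (size q).-1 = (k + 1 + i)%N.
    by rewrite addn1 addSn subnK; case: (size q).-1 lt_i.
  rewrite exprD [in LHS]exprD expr1.
  have fieldE (a b c u v : F) :
      v != 0 -> a * (b / v) * (c * u * v) = u * (a * b * c).
    by move=> v_neq0; field.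
  exact/fieldE/expf_neq0.
(* Transcendence of [x] lifts the identity from values in [F] to polynomials over [F]. *)
have {}bE : map_poly f d1 ^+ (N * (size q).-1) = map_poly f g * map_poly f b.
  apply/eqP; rewrite -rmorphXn -rmorphM -subr_eq0 -rmorphB; apply/eqP/inj.
  by rewrite rmorphB rmorphXn /= -bE subrr.
have : coprimep (map_poly f g) (map_poly f d1 ^+ (N * (size q).-1)).
  apply: coprimep_expr; rewrite gfE coprimep_sym addrC.
  by rewrite coprimep_addl_mul coprimep1.
rewrite bE coprimepMr coprimepp g_size => /andP[/eqP[] /eqP].
by rewrite size_poly_eq0 (negPf d1f_neq0).
Qed.

Lemma residue_field (K : fieldType) (R : comAlgType K) (m : set R) :
  maximal_ideal m ->
  exists (F : fieldType) (p : {rmorphism R -> F}),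
    (forall u, exists a, p a = u) /\ forall a, p a = 0 <-> m a.
Proof.
move=> [[m0 mD mM] m1 max_m]; pose S : {pred R} := fun a => `[< m a >].
have SP a : reflect (m a) (a \in S) by apply: asboolP.
have mN a : m a -> m (- a) by rewrite -mulN1r; apply: mM.
have S_ideal : idealr_closed S.
  split; [exact/SP | exact/SP | move=> a u v /SP ? /SP ?].
  by apply/SP; apply: mD => //; apply: mM.
pose I := HB.pack_for (idealr R) (S : R -> bool)
  (isIdealr.Build R S S_ideal).
pose Q : comNzRingType := {ideal_quot I}.
pose p : {rmorphism R -> Q} := \pi_{ideal_quot I}%qT.
have p0 a : p a = 0 <-> m a.
  rewrite -(rmorph0 p) /=; split=> [/eqP|ma]; last apply/eqP.
    by rewrite piE /= Quotient.equivE subr0 => /SP.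
  by rewrite piE /= Quotient.equivE subr0; apply/SP.
have pinv (u : Q) : exists v : Q, (u != 0 -> v * u = 1) /\ (u = 0 -> v = 0).
  have [->|u_neq0] := eqVneq u 0; first by exists 0.
  (* The ideal generated by [m] and a representative of [u]: if it contains 1, the coefficient [a]
     gives the inverse; otherwise it equals [m] and [u = 0]. *)
  pose n : set R := [set b | exists a c, m c /\ b = a * repr u + c].
  have pu : p (repr u) = u by rewrite /p /= reprK.
  have [n1|n1] := pselect (n 1).
    have [a [c [mc e]]] := n1; exists (p a); split=> [_|u0].
      rewrite -(rmorph1 p) e rmorphD rmorphM /= pu.
      by move/p0: mc => ->; rewrite addr0.
    by rewrite u0 eqxx in u_neq0.
  have nm : n = m.
    apply: max_m => //; last by move=> b mb; exists 0, b; rewrite mul0r add0r.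
    split; first by exists 0, 0; rewrite mul0r addr0.
      move=> _ _ [a [c [mc ->]]] [a' [c' [mc' ->]]].
      by exists (a + a'), (c + c'); split; [apply: mD | rewrite mulrDl addrACA].
    move=> b _ [a [c [mc ->]]]; exists (b * a), (b * c).
    by split; [apply: mM | rewrite mulrDr mulrA].
  have : m (repr u).
    by rewrite -nm; exists 1, 0; rewrite mul1r addr0.
  by move/p0; rewrite pu => u0; rewrite u0 eqxx in u_neq0.
have [inv invP] := choice pinv.
pose F := HB.pack_for fieldType Q (GRing.ComNzRing_isField.Build Q
  (fun x => (invP x).1) ((invP 0).2 erefl)).
exists F, p; split=> // u; exists (repr (u : {ideal_quot I})).
by rewrite /p /= reprK.
Qed.

(** In Zariski's lemma over [D = K] the denominator [d] is already a unit, so each residue is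
    algebraic over [K], hence a scalar. *)
Lemma maximal_ideal_residue (K : closedFieldType) (R : comAlgType K)
    (m : set R) :
  fin_gen R -> maximal_ideal m -> forall a, exists c : K, m (a - c%:A).
Proof.
move=> [s gen] /residue_field[F [p [p_surj p0]]] a.
pose f : {rmorphism K -> F} := p \o in_alg R.
have [P Pf PD PM Ps|d d_neq0 /(_ (p a))[N du]] := @zariski F (map p s) K f.
  move=> u; have [b <-] := p_surj u.
  apply: (gen (fun b => P (p b))) => [c|b1 b2|b1 b2|b1 bs].
  - exact: Pf.
  - by rewrite rmorphD; apply: PD.
  - by rewrite rmorphM; apply: PM.
  - by apply: Ps; apply: map_f.
have {du}[q mon_q qa] : integralOver f (p a).
  have -> : p a = f (d ^+ N)^-1 * (f d ^+ N * p a).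
    by rewrite fmorphV rmorphXn mulKf // expf_neq0.
  by apply: integral_mul => //; apply: integral_id.
have [r qE] := closed_field_poly_normal q.
move: qa; rewrite qE (monicP mon_q) scale1r rmorph_prod rootE horner_prod.
rewrite prodf_seq_eq0 => /hasP[c _ /=].
rewrite rmorphB /= map_polyX map_polyC hornerXsubC subr_eq0 => /eqP pa.
by exists c; apply/p0; rewrite rmorphB pa subrr.
Qed.

(** * The sums of q-integers *)

Section ScalarSequence.
Variables (K : fieldType) (charK : [pchar K] =i pred0).

(** [order_N q] is also [None] when [q ^+ 2 = 1]; outside that case [None] excludes all roots of
    unity. *)
Lemma order_N_infinite (q : K) (n : nat) :
  order_N q = None -> q ^+ 2 != 1 -> (0 < n)%N -> q ^+ n != 1.
Proof.
rewrite /order_N; case: pselect => [ex|no_ex]; first by case: ifP.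
move=> _ _ n_gt0; apply/eqP => qn; apply: no_ex.
by have [k prim_q _] := prim_order_exists n_gt0 qn; exists k.
Qed.

Lemma natr_odd_sqr_inj (i j : nat) :
  (i.*2.+1)%:R ^+ 2 = (j.*2.+1)%:R ^+ 2 :> K -> i = j.
Proof.
rewrite -!natrX => /eqP.
wlog le_ij : i j / (i <= j)%N => [th|].
  by have [/th//|/ltnW/th] := leqP i j; rewrite eq_sym => e /e.
have le2 : (i.*2.+1 ^ 2 <= j.*2.+1 ^ 2)%N by rewrite leq_exp2r // ltnS leq_double.
rewrite eq_sym -subr_eq0 -natrB // ((pcharf0P K).1 charK) subn_eq0.
by rewrite leq_exp2r // ltnS leq_double => le_ji; apply/eqP; rewrite eqn_leq le_ij.
Qed.

Variables (q b : K) (u : nat -> K).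
Hypotheses (q_neq0 : q != 0) (b_neq0 : b != 0) (q_order : order_N q = None).
Hypotheses (u0 : u 0%N = b).
Hypothesis (uS : forall k, u k.+1 = q * u k + q ^- k.+1 * b).

Let S j := \sum_(k < j) u k.

(** Two geometric sums: [q ^+ 2 - 1] clears the denominator of [u k], and [q - 1] that of the sum
    over [k]. *)
Lemma sum_generic j :
  q ^+ 2 != 1 ->
  (q ^+ 2 - 1) * (q - 1) * S j = b * q * (q * q ^+ j + q ^- j - q - 1).
Proof.
move=> q2_neq1.
have uE k : (q ^+ 2 - 1) * u k = b * (q ^+ 2 * q ^+ k - q ^- k).
  elim: k => [|k IHk]; first by rewrite u0 !expr0 invr1; ring.
  have q_neq0' : q ^+ k != 0 by rewrite expf_neq0.
  rewrite uS mulrDr mulrCA IHk !exprS; field.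
  by rewrite q_neq0 q_neq0'.
elim: j => [|j IHj]; first by rewrite /S big_ord0 !expr0 invr1; ring.
have q_neq0' : q ^+ j != 0 by rewrite expf_neq0.
rewrite /S big_ord_recr /= -/(S j) mulrDr IHj [_ * u j]mulrAC uE !exprS; field.
by rewrite q_neq0 q_neq0'.
Qed.

(** Here [u k = b * (k + 1)], and 8 times a triangular number is an odd square minus 1. *)
Lemma sum_one j : q = 1 -> S j *+ 8 = b * ((j.*2.+1)%:R ^+ 2 - 1).
Proof.
move=> q1; have uE k : u k = b * k.+1%:R.
  elim: k => [|k IHk]; first by rewrite u0 mulr1.
  by rewrite uS IHk q1 expr1n invr1 -[in RHS]natr1; ring.
elim: j => [|j IHj]; first by rewrite /S big_ord0 -[0.*2.+1]/1%N; ring.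
rewrite /S big_ord_recr /= -/(S j) mulrnDl IHj uE doubleS -!mul2n.
by rewrite -!natr1 !natrM; ring.
Qed.

Lemma sum_minus_one j :
  q = -1 -> S j *+ 4 = b * (1 - (-1) ^+ j * (j.*2.+1)%:R).
Proof.
move=> q1; have uE k : u k = b * ((-1) ^+ k * k.+1%:R).
  elim: k => [|k IHk]; first by rewrite u0 expr0 mul1r mulr1.
  by rewrite uS IHk q1 -exprVn invrN1 exprS -[in RHS]natr1; ring.
elim: j => [|j IHj]; first by rewrite /S big_ord0 expr0 -[0.*2.+1]/1%N; ring.
rewrite /S big_ord_recr /= -/(S j) mulrnDl IHj uE doubleS -!mul2n exprS.
by rewrite -!natr1 !natrM; ring.
Qed.

Lemma sum_inj i j : S i = S j -> i = j.
Proof.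
move=> Sij; have [q2|q2_neq1] := eqVneq (q ^+ 2) 1.
  have /orP[/eqP q1|/eqP q1] : (q == 1) || (q == -1).
    by rewrite -eqf_sqr q2 expr1n.
    apply: natr_odd_sqr_inj; have := sum_one j q1.
    by rewrite -Sij sum_one // => /(mulfI b_neq0)/addIr.
  apply: natr_odd_sqr_inj; have := sum_minus_one j q1.
  rewrite -Sij sum_minus_one // => /(mulfI b_neq0)/addrI/oppr_inj.
  by move/(congr1 (fun x => x ^+ 2)); rewrite !exprMn !sqrr_sign !mul1r.
have q_inf n := order_N_infinite (n := n) q_order q2_neq1.
(* This is the difference of the two values of [q * q ^+ j + q ^- j], multiplied by [q ^+ (i + j)].
   The second factor is nonzero because its exponent is positive. *)
have : (q ^+ i - q ^+ j) * (q ^+ (i + j).+1 - 1) = 0.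
  have := sum_generic j q2_neq1.
  rewrite -Sij sum_generic // => /(mulfI (mulf_neq0 b_neq0 q_neq0))/addIr/addIr.
  have qi : q ^+ i != 0 by rewrite expf_neq0.
  have qj : q ^+ j != 0 by rewrite expf_neq0.
  move=> /(congr1 (fun x => x * (q ^+ i * q ^+ j)))/eqP.
  rewrite -subr_eq0 => /eqP <-; rewrite exprS exprD; field.
  by rewrite qi qj.
move/eqP; rewrite mulf_eq0 !subr_eq0 (negPf (q_inf _ _)) // orbF.
wlog le_ij : i j {Sij} / (i <= j)%N => [th|].
  by have [/th//|/ltnW/th] := leqP i j; rewrite eq_sym => e /e.
rewrite -(subnK le_ij) exprD -{1}[q ^+ i]mul1r.
rewrite (inj_eq (mulIf (expf_neq0 _ q_neq0))) eq_sym => qij.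
have [->|] := posnP (j - i); first by rewrite add0n.
by move/q_inf; rewrite qij.
Qed.

End ScalarSequence.

(** * Characters of the Hopf algebra *)

Section Convolution.
Variables (K : fieldType) (R : comAlgType K) (H : hopf R).
Implicit Types phi psi : {lrmorphism R -> K^o}.

Lemma tlift_sum (U V W : lmodType K) (b : U -> V -> W) I (r : seq I) x :
  is_bilinear b -> tlift b (\sum_(i <- r) x i) = \sum_(i <- r) tlift b (x i).
Proof.
move=> bb; pose B := HB.pack_for {linear tensor U V -> W} (tlift b)
  (GRing.isLinear.Build _ _ _ _ _ (tlift_is_linear bb)).
exact: (linear_sum B).
Qed.

Lemma tlift_tmap (U V U' V' W : lmodType K) (b : U' -> V' -> W)
    (f : U -> U') (g : V -> V') x :
  is_bilinear b ->
  tlift b (tmap f g x) = tlift (fun u v => b (f u) (g v)) x.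
Proof.
move=> bb; rewrite /tmap {1}/tlift /sum_bil.
rewrite -[LHS]/(tlift b (\sum_(p <- repr x) (f p.1 (x) g p.2))) tlift_sum //.
by apply: eq_bigr => p _; rewrite tlift_tens.
Qed.

(** Composed with [comul H], this is the convolution of characters, that is, the addition of [G]. *)
Definition tensor_eval phi psi : tensor R R -> K^o :=
  tlift (fun a b => phi a * psi b : K^o).

Lemma tensor_eval_bilinear phi psi :
  is_bilinear (fun a b => phi a * psi b : K^o).
Proof.
split=> [b c u v|a c u v]; rewrite linearP /=.
  by rewrite mulrDl -scalerAl.
by rewrite mulrDr -scalerAr.
Qed.

Lemma tensor_eval_tens phi psi a b : tensor_eval phi psi (a (x) b) = phi a * psi b.
Proof. exact/tlift_tens/tensor_eval_bilinear. Qed.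

Lemma tensor_evalD phi psi x y :
  tensor_eval phi psi (x + y) = tensor_eval phi psi x + tensor_eval phi psi y.
Proof. exact/tlift_add/tensor_eval_bilinear. Qed.

Lemma tensor_evalZ phi psi c x :
  tensor_eval phi psi (c *: x) = c * tensor_eval phi psi x.
Proof. exact/tlift_scale/tensor_eval_bilinear. Qed.

Lemma lrmorphism_of (f : R -> K^o) :
  linear f -> (forall a b, f (a * b) = f a * f b) -> f 1 = 1 ->
  {phi : {lrmorphism R -> K^o} | phi =1 f}.
Proof.
move=> fL fM f1.
by exists (HB.pack_for {lrmorphism R -> K^o} f
  (GRing.isLinear.Build K R K^o *:%R f fL)
  (GRing.isMonoidMorphism.Build R K^o f (conj f1 fM))).
Qed.

Definition counit_char : {lrmorphism R -> K^o} :=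
  sval (lrmorphism_of (linearP (counit H)) (counitM H) (counit1 H)).

Lemma counit_charE : counit_char =1 counit H.
Proof. exact: (svalP (lrmorphism_of _ _ _)). Qed.

Lemma tensor_eval_counit phi a : tensor_eval phi counit_char (comul H a) = phi a.
Proof.
rewrite -[in RHS](counitr H a) /tensor_eval /tlift /sum_bil linear_sum.
by apply: eq_bigr => p _; rewrite linearZ counit_charE mulrC.
Qed.

Lemma char_scalar phi (c : K) : phi c%:A = c.
Proof. by rewrite linearZ rmorph1; apply: mulr1. Qed.

(** The default of [xget] is never reached: [phi a] is a candidate, and the only one. *)
Lemma ev_char phi (m : set R) : (forall a, m a <-> phi a = 0) -> ev m = phi.
Proof.
move=> mE; apply/funext => a; rewrite /ev.
have phiZ (c : K) : phi (a - c%:A) = phi a - c.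
  by rewrite rmorphB /= char_scalar.
case: xgetP => [c -> /= /mE|/(_ (phi a))[]]; last by apply/mE; rewrite phiZ subrr.
by rewrite phiZ => /eqP; rewrite subr_eq0 => /eqP.
Qed.

Lemma char_unit phi a b : a * b = 1 -> phi a != 0 /\ phi b != 0.
Proof.
move=> ab; apply/andP; rewrite -negb_or -mulf_eq0 -rmorphM ab rmorph1.
exact: oner_neq0.
Qed.

(** The counit axiom on [x (x) x] makes the counit of [x] idempotent, and it is nonzero since [x] is
    a unit. *)
Lemma counit_grouplike x y : grouplike H x -> x * y = 1 -> counit_char x = 1.
Proof.
move=> gx /(char_unit counit_char)[x_neq0 _]; apply: (mulfI x_neq0).
by rewrite mulr1 -tensor_eval_tens -gx tensor_eval_counit.
Qed.

Section Shift.
Variables (sigma sigmaV : {lrmorphism R -> R}).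
Hypotheses (sigmaK : cancel sigma sigmaV) (sigmaVK : cancel sigmaV sigma).
Hypothesis sigma_comul :
  forall a, tmap id sigma (comul H a) = comul H (sigma a).

(** The character of [m + n] when [phi] is that of [m]. *)
Fixpoint shift phi n : {lrmorphism R -> K^o} :=
  if n is n'.+1 then shift phi n' \o sigmaV else phi.

Lemma shiftS phi n a : shift phi n.+1 (sigma a) = shift phi n a.
Proof. by rewrite /= sigmaK. Qed.

Lemma shiftE phi n a : shift phi n a = phi (iter n sigmaV a).
Proof. by elim: n a => // n IHn a; rewrite iterSr -IHn. Qed.

(** Induction from the counit axiom: each step moves one [sigma] through [comul H] into the second
    factor, where [sigmaV] cancels it. *)
Lemma tensor_eval_shift phi n a :
  tensor_eval phi (shift counit_char n) (comul H a) = shift phi n a.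
Proof.
elim: n a => [|n IHn] a; first exact: tensor_eval_counit.
rewrite -[a]sigmaVK shiftS -IHn -sigma_comul.
rewrite /tensor_eval tlift_tmap; last exact: tensor_eval_bilinear.
by congr tlift; do 2!apply/funext => ?; rewrite /= sigmaK.
Qed.

Lemma wint_nat (n : nat) a :
  wint sigma sigmaV H n a <-> shift counit_char n a = 0.
Proof.
rewrite shiftE counit_charE; split=> [[b /= b0 <-]|a0].
  suff -> : iter n sigmaV (iter n sigma b) = b by [].
  by elim: n => // n IHn; rewrite iterSr /= sigmaK.
exists (iter n sigmaV a) => //=.
by elim: n {a0} => // n IHn; rewrite iterSr /= sigmaVK.
Qed.

Lemma wadd_wint phi (m : set R) (n : nat) a :
  (forall a, m a <-> phi a = 0) ->
  wadd H m (wint sigma sigmaV H n) a <-> shift phi n a = 0.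
Proof.
move=> mE; rewrite /wadd /= (ev_char mE) (ev_char (wint_nat n)).
by rewrite -tensor_eval_shift.
Qed.

End Shift.
End Convolution.

(** The residue scalar is unique because [m] is proper, and uniqueness makes it linear and
    multiplicative in [a]. *)
Lemma maximal_ideal_char (K : closedFieldType) (R : comAlgType K) (m : set R) :
  fin_gen R -> maximal_ideal m ->
  exists phi : {lrmorphism R -> K^o}, forall a, m a <-> phi a = 0.
Proof.
move=> fgR maxm; have /choice[f fP] := maximal_ideal_residue fgR maxm.
have [[m0 mD mM] m1 _] := maxm.
have f_uniq a c : m (a - c%:A) -> f a = c.
  move=> mc; apply/eqP; rewrite -subr_eq0; apply/negP => /negP nz; apply: m1.
  have -> : 1 = (f a - c)^-1%:A * ((a - c%:A) + (-1) * (a - (f a)%:A)).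
    rewrite mulN1r opprB [X in _ * X]addrC subrKA.
    by rewrite -scalerBl -scalerAl mul1r scalerA mulVf // scale1r.
  by apply/mM/mD => //; apply: mM.
have f_linear : linear (f : R -> K^o).
  move=> c a b; rewrite -[RHS]/(c * f a + f b); apply: f_uniq.
  have -> : c *: a + b - (c * f a + f b)%:A
    = c%:A * (a - (f a)%:A) + (b - (f b)%:A).
    rewrite mulrBr -!scalerAl !mul1r scalerA.
    rewrite scalerDl opprD addrACA; congr (_ + _).
  by apply: mD => //; apply: mM.
have f_mul : {morph f : a b / a * b}.
  move=> a b; apply: f_uniq.
  have -> : a * b - (f a * f b)%:A = b * (a - (f a)%:A) + (f a)%:A * (b - (f b)%:A).
    rewrite !mulrBr -!scalerAl -!scalerAr !mul1r !mulr1 scalerA [b * a]mulrC.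
    by rewrite addrA subrK.
  by apply: mD; apply: mM.
have f1 : f 1 = 1 by apply: f_uniq; rewrite scale1r subrr.
have [phi phiE] := lrmorphism_of f_linear f_mul f1.
exists phi => a; rewrite phiE; split=> [ma|fa0].
  by apply: f_uniq; rewrite scale0r subr0.
by have := fP a; rewrite fa0 scale0r subr0.
Qed.

(** * The Casimir scalar *)

Section Casimir.
Variables (K : fieldType) (R : comAlgType K).
Variables (sigma sigmaV : {lrmorphism R -> R}).
Hypotheses (sigmaK : cancel sigma sigmaV) (sigmaVK : cancel sigmaV sigma).
Variables (h : R) (xi : K).

(** The constant term of [sigma^j(t)] as a polynomial in [t]. *)
Fixpoint casimir_const j : R :=
  if j is j'.+1 then sigma (casimir_const j') + xi ^+ j' *: h else 0.

Lemma iter_sigmat j :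
  iter j (sigmat sigma h xi) 'X = (casimir_const j)%:P + (xi ^+ j)%:A *: 'X.
Proof.
elim: j => [|j IHj]; first by rewrite /= expr0 !scale1r add0r.
rewrite iterS IHj /sigmat rmorphD /= map_polyC map_polyZ map_polyX /=.
rewrite comp_polyD comp_polyC comp_polyZ comp_polyX linearZ /= rmorph1.
rewrite scalerDr addrA scalerA -scalerAl mul1r scalerA -exprSr.
congr (_ + _); rewrite polyCD; congr (_ + _).
by rewrite -mul_polyC -polyCM -scalerAl mul1r.
Qed.

Lemma shift_casimir_const (phi : {lrmorphism R -> K^o}) j :
  shift sigmaV phi j (casimir_const j) =
  \sum_(k < j) xi ^+ k * shift sigmaV phi k.+1 h.
Proof.
elim: j => [|j IHj]; first by rewrite big_ord0 linear0.
pose psi := shift sigmaV phi j.+1.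
transitivity (psi (sigma (casimir_const j)) + psi (xi ^+ j *: h)).
  exact: rmorphD.
by rewrite (shiftS sigmaK) IHj big_ord_recr; congr (_ + _); apply: linearZ.
Qed.

Variables (A : algType K) (iota : {lrmorphism R -> A}) (Xp Xm : A).

(** The image of the Verma generator generates [L], so it is nonzero. *)
Lemma highest_weight_vector (w : set R) (L : lmodType A) :
  is_simple_quotient_verma iota Xp w L ->
  exists v : L, [/\ v <> 0, Xp *: v = 0 & weight_space iota w v].
Proof.
move=> [[[v0 v0P] _] [M [[pi [pi_surj pi0]] [rho rho_surj]]]].
have piE x : x *: rho (pi 1) = rho (pi x).
  by rewrite -!linearZ /= [x *: 1]mulr1.
have kill x : verma_ideal iota Xp w x -> x *: rho (pi 1) = 0.
  by move=> /pi0 x0; rewrite piE x0 linear0.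
exists (rho (pi 1)); split.
- move=> v10; apply: v0P; have [y <-] := rho_surj v0; have [x <-] := pi_surj y.
  by rewrite -piE v10 scaler0.
- by apply: kill; exists 1, [::]; rewrite big_nil mul1r addr0.
- move=> a wa; apply: kill; exists 0, [:: (1, a)].
  split=> [p|]; first by rewrite inE => /eqP->.
  by rewrite big_seq1 mul0r mul1r add0r.
Qed.

Lemma evalt_casimir (V : lmodType A) j (v : V) :
  Xp *: v = 0 ->
  evalt iota Xp Xm (iter j (sigmat sigma h xi) 'X) *: v =
  iota (casimir_const j) *: v.
Proof.
move=> v0; rewrite iter_sigmat /evalt rmorphD /= map_polyC map_polyZ map_polyX.
rewrite hornerD hornerC hornerZ hornerX scalerDl -!scalerA v0.
by rewrite !scaler0 addr0.
Qed.

Lemma scalar_act_inj (V : lmodType A) (v : V) (c d : K) :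
  v <> 0 -> c%:A *: v = d%:A *: v -> c = d.
Proof.
move=> v0 /eqP; rewrite -subr_eq0 -scalerBl -scalerBl => /eqP cd0.
apply/eqP; rewrite -subr_eq0; apply/negP => /negP cd; apply: v0.
rewrite -[v]scale1r -[1](scale1r 1) -(mulVf cd) -scalerA -[_ *: 1]mul1r.
by rewrite scalerAl -scalerA cd0 scaler0.
Qed.

Lemma casimir_value (H : hopf R) (phi : {lrmorphism R -> K^o}) (m : set R)
    (j : nat) (L : lmodType A) (C : L -> L) (c : K) :
  (forall a, tmap id sigma (comul H a) = comul H (sigma a)) ->
  (forall a, m a <-> phi a = 0) ->
  is_simple_quotient_verma iota Xp (wadd H m (wint sigma sigmaV H j%:Z)) L ->
  is_casimir iota Xp Xm sigma sigmaV h xi H m C ->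
  (forall v, C v = c%:A *: v) ->
  c = \sum_(k < j) xi ^+ k * shift sigmaV phi k.+1 h.
Proof.
move=> sigma_comul mE /highest_weight_vector[v [v0 Xv wv]] [_ CP] Cc.
apply: (scalar_act_inj v0); rewrite -Cc (CP j%:Z v wv) evalt_casimir //.
rewrite -shift_casimir_const; set a := casimir_const j.
apply/eqP; rewrite -subr_eq0 -scalerBl; apply/eqP.
have -> : (shift sigmaV phi j a)%:A = iota (shift sigmaV phi j a)%:A.
  by rewrite linearZ /= rmorph1.
(* [a] minus its value at [m + j] lies in the ideal [m + j], which annihilates [v]. *)
rewrite -rmorphB; apply: wv; apply/(wadd_wint sigmaK sigmaVK sigma_comul _ _ mE).
by rewrite rmorphB /= char_scalar subrr.
Qed.

End Casimir.

Theorem proposition8p1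
  (K : closedFieldType) (charK : [pchar K] =i pred0)
  (R : comAlgType K) (fgR : fin_gen R)
  (sigma sigmaV : {lrmorphism R -> R})
  (sigmaK : cancel sigma sigmaV) (sigmaVK : cancel sigmaV sigma)
  (h : R) (xi : K) (xi_neq0 : xi != 0)
  (A : algType K) (iota : {lrmorphism R -> A}) (Xp Xm : A)
  (ambA : is_ambiskew sigma sigmaV h xi iota Xp Xm)
  (H : hopf R) (rp rm lp lm sp sm : R)
  (HA : hopf_datum sigma sigmaV H h xi rp rm lp lm sp sm)
  (tfree : torsion_free sigma sigmaV)
  (* h(1) <> 0: left implicit in the source, but without it every C_V below is 0
     and the conclusion fails (R = K[H], sigma(H) = H - 1, h = 0, xi = 1) *)
  (h1_neq0 : ev (wint sigma sigmaV H 1) h != 0)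
  (N_infty : order_N (xi * ev (wint sigma sigmaV H 1) (rp * rm)) = None)
  (m : set R) (maxm : maximal_ideal m) (m_G0 : ev m h = 0)
  (j1 j2 : nat) (L1 L2 : lmodType A)
  (L1P : is_simple_quotient_verma iota Xp
           (wadd H m (wint sigma sigmaV H j1%:Z)) L1)
  (L2P : is_simple_quotient_verma iota Xp
           (wadd H m (wint sigma sigmaV H j2%:Z)) L2)
  (C1 : L1 -> L1) (C2 : L2 -> L2)
  (C1P : is_casimir iota Xp Xm sigma sigmaV h xi H m C1)
  (C2P : is_casimir iota Xp Xm sigma sigmaV h xi H m C2)
  (c1 c2 : K)
  (C1_scalar : forall v, C1 v = c1%:A *: v)
  (C2_scalar : forall v, C2 v = c2%:A *: v) :
  c1 = c2 -> j1 = j2.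
Proof.
have [phi mE] := maximal_ideal_char fgR maxm.
have sigma_comul := sigma_comulr HA.
rewrite (casimir_value sigmaK sigmaVK sigma_comul mE L1P C1P C1_scalar).
rewrite (casimir_value sigmaK sigmaVK sigma_comul mE L2P C2P C2_scalar).
pose chi := shift sigmaV (counit_char H).
have ev1 : ev (wint sigma sigmaV H 1) = chi 1%N.
  exact/ev_char/wint_nat.
move: h1_neq0 N_infty m_G0; rewrite ev1 (ev_char mE) => {ev1}.
set q := xi * _ => chi1h q_order phih.
(* The inverses of [sp] and [sm] exhibit [lp], [lm], [sigma rp] and [sigmaV rm] as units; undoing
   the automorphism gives [rp] and [rm]. *)
have unitl (a b c : R) : a * - (b * c) = 1 -> b * (- a * c) = 1.
  by move=> <-; rewrite mulrN !mulNr mulrN mulrCA.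
have unitr (a b c : R) : a * - (b * c) = 1 -> c * (- a * b) = 1.
  by move=> e; apply: unitl; rewrite [c * b]mulrC.
have lpU := unitl _ _ _ (inv_sp HA); have lmU := unitl _ _ _ (inv_sm HA).
have rpU : rp * sigmaV (- sp * lp) = 1.
  by rewrite -[rp in LHS]sigmaK -rmorphM (unitr _ _ _ (inv_sp HA)) rmorph1.
have rmU : rm * sigma (- sm * lm) = 1.
  by rewrite -[rm in LHS]sigmaVK -rmorphM (unitr _ _ _ (inv_sm HA)) rmorph1.
have glp := grouplike_lp HA; have glm := grouplike_lm HA.
have grp := grouplike_rp HA; have grm := grouplike_rm HA.
(* Evaluated at the weight 1 in both factors, the left side of the twist relation becomes a product
   of counits, which is 1. *)
have twist x y : grouplike H x -> grouplike H y ->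
    counit_char H x = 1 -> counit_char H y = 1 ->
    sigma x (x) sigma y = xi *: (x (x) y) -> xi * (chi 1%N x * chi 1%N y) = 1.
  move=> gx gy x1 y1 /(congr1 (tensor_eval (chi 1%N) (chi 1%N))).
  by rewrite tensor_evalZ !tensor_eval_tens /= !sigmaK x1 y1 mulr1.
have t1 := twist _ _ glp grm (counit_grouplike glp lpU)
  (counit_grouplike grm rmU) (sigma_lprm HA).
have t2 := twist _ _ glm grp (counit_grouplike glm lmU)
  (counit_grouplike grp rpU) (sigma_lmrp HA).
(* The product of the two twist relations, regrouped. *)
have xl : (xi * chi 1%N (lp * lm)) * q = 1.
  by rewrite /q !rmorphM -[1]mulr1 -{1}t1 -t2; ring.
have q_neq0 : q != 0 by apply: contra_eq_neq xl => ->; rewrite mulr0 eq_sym oner_eq0.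
have chi_conv k x : tensor_eval (chi k) (chi 1%N) (comul H x) = chi k.+1 x.
  exact: tensor_eval_shift sigmaK sigmaVK sigma_comul (chi k) 1%N x.
have chiM k x y : chi k (x * y) = chi k x * chi k y by exact: rmorphM.
have chi_gl x k : grouplike H x -> chi k.+1 x = chi k x * chi 1%N x.
  by move=> gx; rewrite -tensor_eval_tens -gx chi_conv.
have chi_l k : chi k (lp * lm) = chi 1%N (lp * lm) ^+ k.
  elim: k => [|k IHk].
    rewrite chiM expr0 -[RHS]mulr1; congr (_ * _).
      exact: counit_grouplike glp lpU.
    exact: counit_grouplike glm lmU.
  by rewrite exprSr -IHk !chiM (chi_gl lp k) // (chi_gl lm k) // mulrACA.
(* [comul_h] evaluated at the weights [k] and 1; below, at [m] and [k], its first term vanishes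
   because [h(m) = 0]. *)
have chi_h k : chi k.+1 h = chi k h * chi 1%N (rp * rm) + chi k (lp * lm) * chi 1%N h.
  rewrite -!tensor_eval_tens -tensor_evalD -(comul_h HA).
  by rewrite chi_conv.
have phi_h k : shift sigmaV phi k h = phi (lp * lm) * chi k h.
  rewrite -(tensor_eval_shift sigmaK sigmaVK sigma_comul) (comul_h HA).
  by rewrite tensor_evalD !tensor_eval_tens phih mul0r add0r.
have phil : phi (lp * lm) != 0.
  rewrite rmorphM mulf_neq0 //.
    by have [] := char_unit phi lpU.
  by have [] := char_unit phi lmU.
(* With [u k = xi ^+ k * h(m + k + 1)], [chi_h] becomes the recurrence [uS]: [xi] times [r(1)] is
   [q], and [xi] times [l(1)] is [q^-1]. *)
apply: (@sum_inj K charK q (phi (lp * lm) * chi 1%N h)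
  (fun k => xi ^+ k * shift sigmaV phi k.+1 h)) => //.
- exact: mulf_neq0.
- by rewrite expr0 mul1r phi_h.
- move=> k; rewrite !phi_h chi_h chi_l -exprVn.
  have -> : q^-1 = xi * chi 1%N (lp * lm).
    by apply: (mulIf q_neq0); rewrite xl mulVf.
  by rewrite exprMn /q !exprS; ring.
Qed.
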